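(* Let $\mathbb{K}$ be a commutative field, $U$ and $V$ be $\mathbb{K}$-vector spaces, and $c$ be a positive integer. Let $\mathcal{S}$ be a finite-dimensional reduced minimal $c$-LLD subspace of $\mathcal{L}(U,V)$. Then, $U$ and $V$ are finite-dimensional.
   Context: $\mathcal{L}(U,V)$ is the space of all linear operators from $U$ to $V$. A finite-dimensional linear subspace $\mathcal{S}$ of $\mathcal{L}(U,V)$ is $c$-LLD when, for every $x\in U$, the space $\{f\in\mathcal{S}: f(x)=0\}$ has dimension at least $c$. It is a minimal $c$-LLD subspace when it is minimal, with respect to inclusion, among the $c$-LLD linear subspaces of $\mathcal{L}(U,V)$. It is reduced when $\bigcap_{f\in\mathcal{S}}\operatorname{Ker} f=\{0\}$ and $\sum_{f\in\mathcal{S}}\operatorname{Im} f=V$. *)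

(* Defs.v *)
From mathcomp Require Import all_boot all_algebra.
From mathcomp Require Import boolp classical_sets functions.

Set Implicit Arguments.
Unset Strict Implicit.
Unset Printing Implicit Defensive.

Import GRing.Theory.

Local Open Scope classical_set_scope.
Local Open Scope ring_scope.

Section VectorSpaces.
Variables (K : fieldType) (E : lmodType K).
Implicit Types A : set E.

Definition subspace A : Prop := submod_closed [in A].

Definition is_basis A (n : nat) (b : 'I_n -> E) : Prop :=
  [/\ forall i, A (b i),
      forall v, A v -> exists a : 'I_n -> K, v = \sum_(i < n) a i *: b i
    & forall a : 'I_n -> K, \sum_(i < n) a i *: b i = 0 -> forall i, a i = 0].

(* E is an arbitrary vector space, possibly infinite-dimensional, so the
   dimension is a relation: has_dim A n fails for every n when the subspace A
   is infinite-dimensional. *)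
Definition has_dim A (n : nat) : Prop := exists b : 'I_n -> E, is_basis A b.

Definition finite_dim A : Prop := exists n, has_dim A n.

(* An index may be used several times in the finite sum, which is harmless
   since the A i are meant to be subspaces. *)
Definition sum_subspaces (I : Type) (D : set I) (A : I -> set E) : set E :=
  [set v | exists (n : nat) (k : 'I_n -> I) (w : 'I_n -> E),
     (forall j, D (k j) /\ A (k j) (w j)) /\ v = \sum_(j < n) w j].

End VectorSpaces.

Section Operators.
Variables (K : fieldType) (U V : lmodType K).
Implicit Types S T : set (U -> V).

(* L(U,V) is a set of functions U -> V, its vector space structure being the
   one inherited from the pointwise lmodType structure on U -> V. *)
Definition linear_operators : set (U -> V) := [set f | linear f].

Definition kernel (f : U -> V) : set U := f @^-1` [set 0].

Definition operator_subspace S : Prop :=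
  subspace S /\ S `<=` linear_operators.

(* A subspace of the finite-dimensional S is finite-dimensional, so that its
   dimension d below is a natural number. *)
Definition LLD (c : nat) S : Prop :=
  [/\ operator_subspace S, finite_dim S
    & forall x : U,
        exists2 d : nat, has_dim [set f | S f /\ f x = 0] d & (c <= d)%N].

Definition minimal_LLD (c : nat) S : Prop :=
  LLD c S /\ forall T, LLD c T -> T `<=` S -> T = S.

Definition reduced S : Prop :=
  \bigcap_(f in S) kernel f = [set 0] /\
  sum_subspaces S (fun f => range f) = [set: V].

End Operators.

(* Main.v *)
From HB Require Import structures.
Require Import Defs.
From mathcomp Require Import all_boot all_algebra.
From mathcomp Require Import boolp classical_sets functions.
From mathcomp Require Import zify.

(** For x in U let ev_x : f |-> f x on S. If dim ker ev_x = c, let W be the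
    finite-dimensional image of ev_x and A a complement of W in V. The y in U
    with f y in A for every f in S form a subspace of finite codimension, and
    for such y the equality f (x + y) = 0 forces f x = - f y in A and W, hence
    f x = 0. So ker ev_(x + y) is included in ker ev_x, and equal to it by
    dimension, whence every f in ker ev_x kills y. Thus ker ev_x consists of
    operators of finite rank. By minimality these kernels span S (a proper span
    would lie in a hyperplane of S that is still c-LLD), so every operator in S
    has finite rank; as S is finite-dimensional and reduced, U embeds in a
    finite-dimensional space, and V is a finite sum of images. *)

Set Implicit Arguments.
Unset Strict Implicit.
Unset Printing Implicit Defensive.

Import GRing.Theory.

Local Open Scope classical_set_scope.
Local Open Scope ring_scope.

(** * Subspaces and finite dimension through coordinates in row vectors *)

Section Dimension.
Variable K : fieldType.

Lemma linear_bundle (E1 E2 : lmodType K) (f : E1 -> E2) :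
  linear f -> exists g : {linear E1 -> E2}, g = f :> (E1 -> E2).
Proof.
move=> lf; pose fL := GRing.isLinear.Build K E1 E2 *:%R f lf.
by exists (HB.pack_for {linear E1 -> E2} f fL).
Qed.

Lemma linear_inj (E1 E2 : lmodType K) (f : {linear E1 -> E2}) :
  (forall x, f x = 0 -> x = 0) -> injective f.
Proof. by move=> f0; apply: raddf_inj. Qed.

Lemma subspaceP (E : lmodType K) (A : set E) :
  subspace A <-> A 0 /\ forall a u v, A u -> A v -> A (a *: u + v).
Proof.
split=> -[].
  rewrite !in_setE => A0 lA; split=> // a u v Au Av.
  by apply/set_mem; apply: lA; apply/mem_set.
move=> A0 lA; split=> [|a u v /set_mem Au /set_mem Av]; apply/mem_set => //.
exact: lA.
Qed.

Lemma subspace_sum (E : lmodType K) (A : set E) n (a : 'I_n -> K)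
    (b : 'I_n -> E) :
  subspace A -> (forall i, A (b i)) -> A (\sum_(i < n) a i *: b i).
Proof.
move=> /subspaceP[A0 lA] Ab.
by elim/big_rec: _ => // i v _; apply: lA.
Qed.

Lemma subspace_zeros (E1 E2 : lmodType K) (f : {linear E1 -> E2}) :
  subspace [set x | f x = 0].
Proof.
apply/subspaceP; split=> [|a u v /= fu fv]; first exact: linear0.
by rewrite linearP fu fv scaler0 addr0.
Qed.

Lemma subspace_range (E1 E2 : lmodType K) (f : {linear E1 -> E2}) :
  subspace (range f).
Proof.
apply/subspaceP; split=> [|a _ _ [u _ <-] [v _ <-]].
  by exists 0; rewrite ?linear0.
by exists (a *: u + v); rewrite ?linearP.
Qed.

Lemma linear_row n (E : lmodType K) (h : {linear 'rV[K]_n -> E}) (a : 'rV_n) :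
  h a = \sum_(i < n) a 0 i *: h (delta_mx 0 i).
Proof.
rewrite {1}(row_sum_delta a) linear_sum.
by apply: eq_bigr => i _; rewrite linearZ.
Qed.

Lemma has_dim_coord (E : lmodType K) (A : set E) n :
  subspace A -> has_dim A n ->
  exists h : {linear 'rV[K]_n -> E}, injective h /\ range h = A.
Proof.
move=> sA [b [Ab gb fb]].
have lh : linear (fun a : 'rV[K]_n => \sum_(i < n) a 0 i *: b i).
  move=> k u v; rewrite scaler_sumr -big_split /=; apply: eq_bigr => i _.
  by rewrite !mxE scalerDl scalerA.
have [h hE] := linear_bundle lh; exists h; split.
  apply: linear_inj => a; rewrite hE => /fb a0; apply/rowP => i.
  by rewrite a0 mxE.
rewrite hE; apply/seteqP; split=> [_ [a _ <-]|v /gb[a ->]].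
  exact: subspace_sum.
by exists (\row_i a i) => //; apply: eq_bigr => i _; rewrite mxE.
Qed.

Lemma has_dim_range (E : lmodType K) n (h : {linear 'rV[K]_n -> E}) :
  injective h -> has_dim (range h) n.
Proof.
move=> injh; exists (fun i => h (delta_mx 0 i)); split=> [i|_ [a _ <-]|a].
- by exists (delta_mx 0 i).
- by exists (a 0); apply: linear_row.
- have -> : \sum_(i < n) a i *: h (delta_mx 0 i) = h (\row_i a i).
    by rewrite linear_row; apply: eq_bigr => i _; rewrite mxE.
  rewrite -(linear0 h) => /injh /rowP a0 i.
  by have := a0 i; rewrite !mxE.
Qed.

(** A matrix of maximal rank among those whose row space lies in [A] works: adding a vector of [A]
    to its row space cannot raise the rank. *)
Lemma subspace_row_space n (A : set 'rV[K]_n) :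
  subspace A -> exists M : 'M[K]_n, A = [set a | (a <= M)%MS].
Proof.
move=> /subspaceP[A0 lA].
pose P k := `[< exists M : 'M[K]_n,
  [set a | (a <= M)%MS] `<=` A /\ \rank M = k >].
have exP : exists k, P k.
  exists 0%N; apply/asboolP; exists 0; split; last exact: mxrank0.
  by move=> a /=; rewrite submx0 => /eqP->.
have ubP k : P k -> (k <= n)%N.
  by move=> /asboolP[M [_ <-]]; apply: rank_leq_col.
case: (ex_maxnP exP ubP) => _ /asboolP[M [MA <-]] maxM; exists M.
apply/seteqP; split=> // a Aa /=.
have MaM : (M <= M + a)%MS by apply: addsmxSl.
apply: submx_trans (addsmxSr M a) _.
rewrite -(mxrank_leqif_sup MaM) eqn_leq mxrankS //= maxM //.
apply/asboolP; exists (M + a)%MS; split=> // _ /sub_addsmxP[u ->].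
rewrite addrC [u.2]mx11_scalar mul_scalar_mx.
by apply: lA => //; apply: MA => /=; apply: submxMl.
Qed.

Lemma has_dim_image (E : lmodType K) m n (h : {linear 'rV[K]_n -> E})
    (M : 'M[K]_(m, n)) :
  injective h -> has_dim (h @` [set a | (a <= M)%MS]) (\rank M).
Proof.
move=> injh.
have lh : linear (fun a : 'rV[K]_(\rank M) => h (a *m row_base M)).
  by move=> k u v; rewrite mulmxDl -scalemxAl linearP.
have [h' h'E] := linear_bundle lh.
have -> : h @` [set a | (a <= M)%MS] = range h'.
  rewrite h'E; apply/seteqP; split=> [_ [a /= aM <-]|_ [a _ <-]].
    by move: aM; rewrite -(eq_row_base M) => /submxP[D ->]; exists D.
  by exists (a *m row_base M) => //=; rewrite -(eq_row_base M) submxMl.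
apply: has_dim_range => a b; rewrite h'E => /injh.
exact/row_free_inj/row_base_free.
Qed.

(** As [has_dim] is a relation, this is what turns the lower bounds in [LLD] into lower bounds on
    ranks. Independent vectors lift through [h] to independent rows. *)
Lemma has_dim_image_le (E : lmodType K) m n d (h : {linear 'rV[K]_n -> E})
    (M : 'M[K]_(m, n)) :
  has_dim (h @` [set a | (a <= M)%MS]) d -> (d <= \rank M)%N.
Proof.
move=> [b [hb _ fb]].
have /choice[q qP] : forall i, exists a, (a <= M)%MS /\ h a = b i.
  by move=> i; case: (hb i) => a aM ha; exists a.
pose Q : 'M[K]_(d, n) := \matrix_i q i.
have QM : (Q <= M)%MS by apply/row_subP => i; rewrite rowK; case: (qP i).
suff /eqP <- : row_free Q by apply: mxrankS.
apply: inj_row_free => v; rewrite mulmx_sum_row => vQ.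
apply/rowP => i; rewrite mxE; apply: (fb (v 0)).
transitivity (h 0); last exact: linear0.
rewrite -vQ linear_sum; apply: eq_bigr => j _.
by rewrite linearZ rowK; case: (qP j) => _ ->.
Qed.

(** As [h] may have a kernel, it is restricted to a complement of that kernel, where it is injective
    with the same range. *)
Lemma finite_dim_range (E : lmodType K) n (h : {linear 'rV[K]_n -> E}) :
  finite_dim (range h).
Proof.
have [M ZM] := subspace_row_space (subspace_zeros h).
have hM a : h a = 0 <-> (a <= M)%MS.
  by rewrite -[h a = 0]/([set a | h a = 0] a) ZM.
pose C := row_base (M^C)%MS.
have lh : linear (fun a => h (a *m C)).
  by move=> k u v; rewrite mulmxDl -scalemxAl linearP.
have [h' h'E] := linear_bundle lh.
have -> : range h = range h'.
  rewrite h'E; apply/seteqP; split=> [_ [a _ <-]|_ [a _ <-]]; last first.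
    by exists (a *m C).
  have : (a <= M + M^C)%MS by apply/submx_full/addsmx_compl_full.
  case/sub_addsmxP=> u ->; rewrite linearD.
  have -> : h (u.1 *m M) = 0 by apply/hM/submxMl.
  have : (u.2 *m M^C <= C)%MS by rewrite eq_row_base submxMl.
  by rewrite add0r => /submxP[D ->]; exists D.
exists (\rank (M^C)); apply: has_dim_range; apply: linear_inj => a.
rewrite h'E => /hM aM.
have : (a *m C <= M :&: M^C)%MS.
  by rewrite sub_capmx aM -(eq_row_base (M^C)%MS) submxMl.
rewrite capmx_compl submx0 => /eqP aC0.
by apply: (row_free_inj (row_base_free (M^C)%MS)); rewrite mul0mx.
Qed.

Lemma finite_dim_embedding (E : lmodType K) n (g : {linear E -> 'rV[K]_n}) :
  injective g -> finite_dim [set: E].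
Proof.
move=> injg.
have [M gM] := subspace_row_space (subspace_range g).
have /choice[h hP] : forall a : 'rV_n, exists x, g x = a *m M.
  move=> a; have [x _ gx] : range g (a *m M); last by exists x.
  by rewrite gM /= submxMl.
have lh : linear h.
  by move=> k u v; apply: injg; rewrite linearP !hP mulmxDl scalemxAl.
have [h' h'E] := linear_bundle lh.
suff -> : [set: E] = range h' by apply: finite_dim_range.
apply/seteqP; split=> // x _.
have : (g x <= M)%MS by rewrite -[is_true _]/([set a | (a <= M)%MS] (g x)) -gM.
by case/submxP=> a ga; exists a => //; apply: injg; rewrite h'E hP.
Qed.

(* The left inverse exists because, by Zorn's lemma, range h has a complement. *)
Lemma linear_left_inverse (E : lmodType K) n (h : {linear 'rV[K]_n -> E}) :
  injective h -> exists g : {linear E -> 'rV[K]_n}, cancel h g.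
Proof.
move=> injh.
(* [P] does not ask for 0, so that it holds of the empty set, the union of the empty chain; [A 0] is
   then drawn from maximality. *)
pose P (A : set E) := (forall a u v, A u -> A v -> A (a *: u + v)) /\
  forall w, A (h w) -> w = 0.
have [F FP Ftot|A [[lA Ah] maxA]] := @Zorn_bigcup E P.
  split=> [a u v [X FX Xu] [Y FY Yv]|w [X FX Xw]]; last first.
    by case: (FP _ FX) => _; apply.
  have [XY|YX] := Ftot _ _ FX FY.
    by exists Y => //; case: (FP _ FY) => + _; apply => //; apply: XY.
  by exists X => //; case: (FP _ FX) => + _; apply => //; apply: YX.
have maxA' B : A `<=` B -> P B -> B `<=` A.
  by move=> AB PB; apply: contrapT => BA; apply: (maxA B).
have A0 : A 0.
  pose B := [set u | A u \/ u = 0].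
  apply: (maxA' B); [by left| |by right].
  split=> [a u v|w].
    case=> [Au|->]; last by rewrite scaler0 add0r.
    case=> [Av|->]; first by left; apply: lA.
    left; have := lA (a - 1) u u Au Au.
    by rewrite scalerBl scale1r subrK addr0.
  by case=> [/Ah//|hw]; apply: injh; rewrite hw linear0.
have /choice[g gP] : forall v, exists w, A (v - h w).
  move=> v; apply: contrapT => nA.
  (* A vector [v] outside [A + range h] could be adjoined to [A] without meeting [range h] outside
     0, against maximality. *)
  pose B := [set a *: v + u | a in [set: K] & u in A].
  have AB : A `<=` B.
    by move=> u Au; exists 0 => //; exists u => //; rewrite scale0r add0r.
  have PB : P B.
    split=> [k _ _ [a _ [u Au <-]] [b _ [w Aw <-]]|w [a _ [u Au hw]]].
      exists (k * a + b) => //; exists (k *: u + w); first exact: lA.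
      by rewrite scalerDr scalerDl scalerA addrACA.
    have [a0|a0] := eqVneq a 0.
      by apply: Ah; rewrite -hw a0 scale0r add0r.
    exfalso; apply: nA; exists (a^-1 *: w).
    rewrite linearZ /= -hw scalerDr scalerA mulVf // scale1r opprD addNKr.
    by have := lA (- a^-1) u 0 Au A0; rewrite addr0 scaleNr.
  apply: nA; exists 0; rewrite linear0 subr0; apply: (maxA' B) => //.
  by exists 1 => //; exists 0 => //; rewrite scale1r addr0.
have gU v w : A (v - h w) -> g v = w.
  move=> Avw; apply/eqP; rewrite -subr_eq0; apply/eqP/Ah.
  have := lA (-1) _ _ (gP v) Avw.
  by rewrite scaleN1r opprB addrA subrK linearB.
have lg : linear g.
  move=> k u v; apply: gU; rewrite linearP opprD addrACA -scalerBr.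
  exact: lA.
have [g' g'E] := linear_bundle lg; exists g' => w.
by rewrite g'E; apply: gU; rewrite subrr.
Qed.

(** The zeros of [g] serve as the complement of [range h], cut out by finitely many linear
    equations. *)
Lemma linear_retraction (E : lmodType K) n (h : {linear 'rV[K]_n -> E}) :
  exists r (g : {linear E -> 'rV[K]_r}), forall a, g (h a) = 0 -> h a = 0.
Proof.
have [r /(has_dim_coord (subspace_range h))[h' [injh' rh']]] :=
  finite_dim_range h.
have [g gK] := linear_left_inverse injh'.
exists r, g => a; have : range h' (h a) by rewrite rh'; exists a.
by case=> b _ <-; rewrite gK => ->; rewrite linear0.
Qed.

End Dimension.

(** * Finite-rank operators in a minimal LLD space *)

Section OperatorSpaces.
Variables (K : fieldType) (U V : lmodType K).

(* f vanishes on a subspace of finite codimension, i.e. f has finite rank when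
   it is linear. *)
Definition finite_corank (f : U -> V) : Prop :=
  exists k (g : {linear U -> 'rV[K]_k}), forall y, g y = 0 -> f y = 0.

Lemma finite_corank0 : finite_corank 0.
Proof.
have [g _] := @linear_bundle K U 'rV[K]_0 (fun=> 0)
  (fun a u v => esym (etrans (addr0 _) (scaler0 _ a))).
by exists 0%N, g.
Qed.

Lemma common_zeros n (f : 'I_n -> U -> V) :
  (forall i, finite_corank (f i)) ->
  exists k (g : {linear U -> 'rV[K]_k}),
    forall y, g y = 0 -> forall i, f i y = 0.
Proof.
elim: n f => [|n IHn] f fcf.
  by have [k [g _]] := finite_corank0; exists k, g => y _ [].
have [k1 [g1 g1P]] := fcf ord0.
have [k2 [g2 g2P]] := IHn (fun i => f (lift ord0 i)) (fun i => fcf _).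
have lg : linear (fun y => row_mx (g1 y) (g2 y)).
  by move=> a u v; rewrite !linearP scale_row_mx add_row_mx.
have [g gE] := linear_bundle lg; exists (k1 + k2)%N, g => y.
rewrite gE -row_mx0 => /eq_row_mx[y1 y2] i.
have [j ->|->] := unliftP ord0 i; [exact: g2P | exact: g1P].
Qed.

Lemma finite_corank_subspace : subspace finite_corank.
Proof.
apply/subspaceP; split=> [|a f1 f2 fc1 fc2]; first exact: finite_corank0.
have [|k [g gP]] := @common_zeros 2 (fun i => if i == ord0 then f1 else f2).
  by move=> i; case: ifP.
exists k, g => y gy.
have f1y : f1 y = 0 by apply: (gP y gy ord0).
have f2y : f2 y = 0 by apply: (gP y gy ord_max).
by rewrite addrfctE scalrfctE f1y f2y scaler0 addr0.
Qed.

Section Coordinates.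
(** In coordinates the kernels of evaluation become row spaces, so that their dimensions are
    ranks. *)
Variables (n : nat) (F : {linear 'rV[K]_n -> (U -> V)}) (N : U -> 'M[K]_n).
Hypotheses (linF : forall a, linear (F a))
  (NP : forall x a, (a <= N x)%MS <-> F a x = 0).

Lemma kernel_finite_corank x a :
  (forall y, (\rank (N x) <= \rank (N y))%N) ->
  F a x = 0 -> finite_corank (F a).
Proof.
move=> minx ax0.
have lev : linear (fun b => F b x) by move=> k b1 b2; rewrite linearP.
have [ev evE] := linear_bundle lev.
have [r [g gP]] := linear_retraction ev.
(* The zeros of this map are the [y] that every operator sends into the zeros of [g]: [r] equations
   for each of the [n] coordinate operators. *)
have lG : linear (fun y => mxvec (\matrix_i g (F (delta_mx 0 i) y))).
  move=> k u v; rewrite -linearP; congr mxvec.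
  by apply/matrixP => i z; rewrite !mxE linF linearP !mxE.
have [G GE] := linear_bundle lG; exists (n * r)%N, G => y.
rewrite GE => /(canRL mxvecK); rewrite linear0 => /row_matrixP Gy.
have gF b : g (F b y) = 0.
  rewrite (linear_row F) fct_sumE linear_sum big1 // => i _.
  by have := Gy i; rewrite rowK row0 scalrfctE linearZ /= => ->; rewrite scaler0.
have FD b : F b (x + y) = F b x + F b y.
  by have := linF b 1 x y; rewrite !scale1r.
have Nxy : (N (x + y) <= N x)%MS.
  apply/row_subP => i; apply/NP; rewrite -[F _ x]/((fun b => F b x) _) -evE.
  apply: gP; rewrite evE.
  have /NP : (row i (N (x + y)) <= N (x + y))%MS by apply: row_sub.
  rewrite FD => /(congr1 g); rewrite linearD gF addr0 => ->.
  exact: linear0.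
have /NP aNx := ax0.
have : (N x <= N (x + y))%MS.
  by rewrite -(mxrank_leqif_sup Nxy) eqn_leq minx mxrankS.
by move=> /(submx_trans aNx)/NP; rewrite FD ax0 add0r.
Qed.

(** Within the image of [H], the kernel of evaluation at [x] is the image of [H :&: N x]. *)
Lemma LLD_image m c (H : 'M[K]_(m, n)) :
  injective F -> (forall x, (c <= \rank (H :&: N x)%MS)%N) ->
  LLD c (F @` [set a | (a <= H)%MS]).
Proof.
move=> injF cHN; split.
- split; last by move=> _ [a _ <-]; apply: linF.
  apply/subspaceP; split=> [|k _ _ [a aH <-] [b bH <-]].
    by exists 0; [apply: sub0mx | rewrite linear0].
  exists (k *: a + b); last by rewrite linearP.
  by apply: addmx_sub; rewrite ?scalemx_sub.
- by exists (\rank H); apply: has_dim_image.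
- move=> x; exists (\rank (H :&: N x)%MS) => //.
  suff -> : [set f | (F @` [set a | (a <= H)%MS]) f /\ f x = 0] =
      F @` [set a | (a <= H :&: N x)%MS] by apply: has_dim_image.
  apply/seteqP; split=> [_ [[a aH <-] /NP aN]|_ [a /= + <-]].
    by exists a; rewrite //= sub_capmx aH.
  by rewrite sub_capmx => /andP[aH /NP]; split=> //; exists a.
Qed.

(* The hyperplane H of the proof is c-LLD: where the kernel of evaluation has
   dimension c it lies in H, and elsewhere cutting by H loses at most one
   dimension. *)
Lemma minimal_LLD_finite_corank c :
  injective F -> minimal_LLD c (range F) -> forall a, finite_corank (F a).
Proof.
move=> injF [[_ _ lldF] minF].
have cN x : (c <= \rank (N x))%N.
  have [d] := lldF x.
  suff -> : [set f | range F f /\ f x = 0] = F @` [set a | (a <= N x)%MS].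
    by move=> /has_dim_image_le dN cd; apply: leq_trans cd dN.
  apply/seteqP; split=> [_ [[a _ <-] /NP aN]|_ [a /NP aN <-]].
    by exists a.
  by split=> //; exists a.
(* The span of the smallest kernels is replaced by the space of all finite-rank operators in the
   range of [F], which contains them. *)
have sA : subspace [set a | finite_corank (F a)].
  have /subspaceP[fc0 fcP] := finite_corank_subspace.
  apply/subspaceP; split=> [|k u v] /=; first by rewrite linear0.
  by rewrite linearP; apply: fcP.
have [M MP] := subspace_row_space sA.
have fcM a : finite_corank (F a) <-> (a <= M)%MS.
  by rewrite -[finite_corank _]/([set a | finite_corank (F a)] a) MP.
suff fullM : row_full M by move=> a; apply/fcM/submx_full.
apply: contrapT => nfullM.
have [j colj] : exists j, col j (cokermx M) != 0.
  apply: contrapT => col0; apply: nfullM.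
  suff : cokermx M = 0 by move=> M0; rewrite -sub1mx submxE M0 mulmx0.
  apply/matrixP => i j; rewrite mxE.
  have /eqP/colP/(_ i) : col j (cokermx M) == 0.
    by apply: contra_notT col0 => colj; exists j.
  by rewrite !mxE.
(* A nonzero column of the cokernel is a nonzero linear form vanishing on [M]; its kernel is a
   hyperplane containing [M]. *)
pose H := kermx (col j (cokermx M)).
have MH : (M <= H)%MS.
  by apply/sub_kermxP; rewrite colE mulmxA mulmx_coker mul0mx.
have rH : (n <= (\rank H).+1)%N.
  by rewrite mxrank_ker -addn1 -leq_subLR subKn // ?rank_leq_col// rank_leq_row.
have /minF TS : LLD c (F @` [set a | (a <= H)%MS]).
  apply: LLD_image => // x.
  have [Nx|Nx] := leqP (\rank (N x)) c.
    suff NH : (N x <= H)%MS.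
      by apply: leq_trans (cN x) _; apply: mxrankS; rewrite sub_capmx NH /=.
    apply: submx_trans MH; apply/row_subP => i; apply/fcM.
    apply: (@kernel_finite_corank x); last by apply/NP/row_sub.
    by move=> y; apply: leq_trans Nx (cN y).
  (* The ranks are at least n - 1 for [H] and c + 1 for [N x], and at most n for their sum, which
     leaves c for the intersection. *)
  have := mxrank_sum_cap H (N x); have := rank_leq_col (H + N x)%MS; lia.
have /TS {}TS : F @` [set a | (a <= H)%MS] `<=` range F.
  by move=> _ [a _ <-]; exists a.
(* If [H] is everything, the chosen column vanishes, a contradiction. *)
suff : (1%:M <= H)%MS by move/sub_kermxP; rewrite mul1mx => /eqP; apply/negP.
apply/row_subP => i.
have : range F (F (row i 1%:M)) by exists (row i 1%:M).
by rewrite -TS => -[a aH /injF <-].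
Qed.

End Coordinates.
End OperatorSpaces.

(** * From finite rank to finite dimension *)

Theorem proposition3p11 (K : fieldType) (U V : lmodType K) (c : nat)
    (S : set (U -> V)) :
  (0 < c)%N -> minimal_LLD c S -> reduced S ->
  finite_dim [set: U]%classic /\ finite_dim [set: V]%classic.
Proof.
move=> _ minS [kerS imS].
have [[[sS linS] [n dimS] _] _] := minS.
have [F [injF rF]] := has_dim_coord sS dimS.
have FS a : S (F a) by rewrite -rF; exists a.
have linF a : linear (F a) by apply: linS.
have /choice[N NP] : forall x, exists M : 'M[K]_n,
    forall a, (a <= M)%MS <-> F a x = 0.
  move=> x.
  have lev : linear (fun b => F b x) by move=> k a b; rewrite linearP.
  have [ev evE] := linear_bundle lev.
  have [M evM] := subspace_row_space (subspace_zeros ev).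
  exists M => a; rewrite -[is_true _]/([set a | (a <= M)%MS] a) -evM.
  by rewrite /= evE.
rewrite -rF in minS.
have fcF := minimal_LLD_finite_corank linF NP injF minS.
(* The zeros of [g] are killed by the basis operators, hence by all of [S], so [g] is injective
   because [S] is reduced. *)
have [k [g gP]] := common_zeros (fun i => fcF (delta_mx 0 i)).
have fdU : finite_dim [set: U].
  apply: (@finite_dim_embedding _ _ _ g); apply: linear_inj => y /gP Fy.
  suff : (\bigcap_(f in S) kernel f) y by rewrite kerS.
  move=> f; rewrite -rF => -[a _ <-] /=.
  rewrite /kernel /= (linear_row F) fct_sumE big1 // => i _.
  by rewrite scalrfctE Fy scaler0.
split=> //.
have sU : subspace [set: U] by apply/subspaceP.
case: fdU => p /(has_dim_coord sU)[hU [_ rU]].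
(* One copy of [U], in [p] coordinates, for each of the [n] basis operators: the range is the sum of
   their images. *)
have lh : linear (fun a : 'rV[K]_(n * p) =>
    \sum_i F (delta_mx 0 i) (hU (row i (vec_mx a)))).
  move=> l a b; rewrite scaler_sumr -big_split; apply: eq_bigr => i _.
  by rewrite !linearP linF.
have [h hE] := linear_bundle lh.
suff -> : [set: V] = range h by apply: finite_dim_range.
apply/seteqP; split=> // v _.
have : sum_subspaces S (fun f => range f) v by rewrite imS.
case=> m [f [w [fw ->]]].
have /subspaceP[h0 hD] := subspace_range h.
elim/big_rec: _ => // j u _ hu; rewrite -[w j]scale1r; apply: hD => //.
have [] := fw j; rewrite -rF => -[a _ <-] [x _ <-].
have : range hU x by rewrite rU.
(* Row i of [a^T *m b] is a_i b, because (sum_i a_i F_i)(x) = sum_i F_i(a_i x). *)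
case=> b _ <-; exists (mxvec (a^T *m b)) => //.
rewrite hE mxvecK (linear_row F a) fct_sumE; apply: eq_bigr => i _.
rewrite scalrfctE row_mul.
have -> : row i a^T = (a 0 i)%:M by apply/rowP=> z; rewrite !mxE ord1 eqxx.
have [L LE] := linear_bundle (linF (delta_mx 0 i)).
by rewrite mul_scalar_mx linearZ /= -LE linearZ.
Qed.
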